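(* Let $(H,\circ)$ be a $\le$-hypergroupoid and $f$ a fuzzy subset of $H$. Then $f$ is a fuzzy filter of $H$ if and only if the complement $f'$ of $f$ is a fuzzy prime ideal of $H$.
   Context: Let ${\cal P}^*(H)$ denote the set of nonempty subsets of $H$. A hypergroupoid $(H,\circ)$ is a nonempty set $H$ with a hyperoperation $\circ : H\times H\to {\cal P}^*(H)$, $(a,b)\mapsto a\circ b$. No associativity is assumed. A $\le$-hypergroupoid is a hypergroupoid $H$ endowed with an arbitrary binary relation denoted $\le$ (not necessarily an order, and not assumed compatible with $\circ$); $b\ge a$ means $a\le b$. A fuzzy subset of $H$ is any mapping $f:H\to[0,1]$. The complement of a fuzzy subset $f$ of $H$ is the fuzzy subset $f':H\to[0,1]$ defined by $f'(x)=1-f(x)$. A fuzzy subset $f$ of $H$ is a fuzzy filter of $H$ if (1) $x\le y$ implies $f(x)\le f(y)$ for all $x,y\in H$, and (2) for all $x,y\in H$ and all $u\in x\circ y$, $f(u)=\min\{f(x),f(y)\}$. A fuzzy subset $f$ of $H$ is a fuzzy prime ideal of $H$ if (1) $x\le y$ implies $f(x)\ge f(y)$ for all $x,y\in H$, and (2) for all $x,y\in H$ and all $u\in x\circ y$, $f(u)=\max\{f(x),f(y)\}$. *)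

(* Defs.v *)
From mathcomp Require Import all_boot all_order all_algebra.
From mathcomp Require Import boolp classical_sets reals interval_inference.

Set Implicit Arguments.
Unset Strict Implicit.
Unset Printing Implicit Defensive.

Import Order.TTheory GRing.Theory Num.Theory.

Local Open Scope classical_set_scope.
Local Open Scope ring_scope.

Record hypergroupoid := Hypergroupoid {
  hcarrier :> Type;
  hcarrier_inhabited : inhabited hcarrier;
  hop : hcarrier -> hcarrier -> set hcarrier;
  hop_nonempty : forall a b, hop a b !=set0 }.

(* The relation is arbitrary: neither an order nor compatible with [hop]. *)
Record le_hypergroupoid := LeHypergroupoid {
  lh_hypergroupoid :> hypergroupoid;
  hle : lh_hypergroupoid -> lh_hypergroupoid -> Prop }.

(* [{i01 R}] is the closed interval [0, 1] of [R]. *)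
Definition fuzzy_subset (R : realType) (H : Type) := H -> {i01 R}.

Definition fuzzy_compl (R : realType) (H : Type) (f : fuzzy_subset R H) :
    fuzzy_subset R H :=
  fun x => (1 - (f x)%:num)%:i01.

Definition fuzzy_filter (R : realType) (H : le_hypergroupoid)
    (f : fuzzy_subset R H) : Prop :=
  (forall x y : H, hle x y -> (f x)%:num <= (f y)%:num) /\
  (forall x y u : H, hop x y u ->
     (f u)%:num = Num.min (f x)%:num (f y)%:num).

Definition fuzzy_prime_ideal (R : realType) (H : le_hypergroupoid)
    (f : fuzzy_subset R H) : Prop :=
  (forall x y : H, hle x y -> (f x)%:num >= (f y)%:num) /\
  (forall x y u : H, hop x y u ->
     (f u)%:num = Num.max (f x)%:num (f y)%:num).

(* Main.v *)
Require Import Defs.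
From mathcomp Require Import all_boot all_order all_algebra.
From mathcomp Require Import boolp classical_sets reals interval_inference.

Import Order.TTheory GRing.Theory Num.Theory.

(** The map t |-> 1 - t is an order-reversing bijection of [0, 1], hence it
    exchanges minima with maxima and is injective.  Applying it to the values
    of f therefore turns each clause defining a fuzzy filter into the
    corresponding clause defining a fuzzy prime ideal, and each clause can be
    recovered from its image: the monotonicity clauses match by [lerD2l] and
    [lerN2], the clauses on products by [subr_minr] and the injectivity. *)

Lemma subr_minr (R : realDomainType) (c a b : R) :
  (c - Num.min a b = Num.max (c - a) (c - b))%R.
Proof. by rewrite oppr_min addr_maxr. Qed.

Theorem proposition17 (R : realType) (H : le_hypergroupoid)
    (f : fuzzy_subset R H) :
  fuzzy_filter f <-> fuzzy_prime_ideal (fuzzy_compl f).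
Proof.
split=> -[f_mono f_hop]; split=> [x y le_xy | x y u xy_u].
- by rewrite /= lerD2l lerN2 f_mono.
- by rewrite /= (f_hop _ _ _ xy_u) subr_minr.
- by have := f_mono _ _ le_xy; rewrite /= lerD2l lerN2.
- by have := f_hop _ _ _ xy_u; rewrite /= -subr_minr => /addrI/oppr_inj.
Qed.
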